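(* Consider dynamic cactus graphs $\mathcal{G}$ on $n$ nodes with at most one dynamic edge at any round, with a whiteboard at every node. Any algorithm that solves the black hole search problem on all such graphs with four agents, which have distinct Ids and are initially co-located, requires, in the worst case, $\Omega(n)$ rounds and $\Omega(n)$ moves.
   Context: Cactus graph: a connected undirected graph in which any two distinct simple cycles share at most one vertex (equivalently, every edge lies on at most one simple cycle). Dynamic cactus graph with at most $k$ dynamic edges at any round: a fixed cactus (the footprint, $G_0$) on a static vertex set $V$ with $|V|=n$, together with a sequence of graphs $G_0,G_1,G_2,\dots$, $G_r=(V,E_r)$, where $G_r$ is the footprint with at most $k$ edges missing, and each $G_r$ is connected ($1$-interval connectivity). At each round an adversary chooses which edges are missing; missing edges may reappear later. The degree $\deg(v)$ is the degree in $G_0$; $\Delta$ is the maximum degree. Nodes are anonymous. At each node $v$ the incident edges carry distinct port numbers $0,\dots,\deg(v)-1$ (in counter-clockwise order); the two port numbers of an edge are unrelated. Each node $v$ has a whiteboard of $O(\deg(v)(\log\deg(v)+k\log k))$ bits, readable and writable by visiting agents under fair mutual exclusion. Black hole: one node of the graph is a black hole; every agent entering it is destroyed without a trace. Agents: a set of $m\le n$ agents with distinct Ids in $[1,m]$, initially co-located at a node called home that is known not to be the black hole. All agents execute the same deterministic algorithm; each has $O(n\log\Delta)$ bits of memory. An agent at a node sees the degree, which incident edges are currently missing, the whiteboard, and the Ids of the other agents there, and can communicate with these agents. When moving along an edge it knows the port by which it leaves and the port by which it arrives. Any number of agents may use an edge simultaneously. Rounds: in every synchronous round each agent communicates (with co-located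 agents and via the whiteboard), computes a decision to stay or to leave through a port, and then moves (traversing a present edge takes one round). The number of moves is the total number of edge traversals made by all agents. Black hole search problem (BHS): within finitely many rounds, at least one agent must survive, know the location of the black hole, and terminate, whatever the footprint, its port numbering, the location of the black hole, and the adversary's choice of missing edges. Here $k=1$ and $m=4$. Worst case means the maximum over all instances with $n$ nodes and all adversary strategies. *)

(* Defs.v *)
From mathcomp Require Import all_boot.

Set Implicit Arguments.
Unset Strict Implicit.
Unset Printing Implicit Defensive.

Section Graphs.

Variable V : finType.
Implicit Types (e : rel V) (port : V -> V -> nat).

Definition degree e (v : V) : nat := #|[pred u | e v u]|.

Definition max_degree e : nat := \max_(v : V) degree e v.

Definition edges e : {set {set V}} :=
  [set [set d.1; d.2] | d : V * V & e d.1 d.2].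

Definition connected e : Prop := forall x y, connect e x y.

Definition simple_cycle e (c : seq V) : bool := (2 < size c) && ucycleb e c.

(* Lists that differ by a rotation or a reversal describe the same cycle;
   the set of edges identifies the cycle as a subgraph. *)
Definition cycle_edges (c : seq V) : {set {set V}} :=
  [set [set x; next c x] | x in c].

Definition cactus e : Prop :=
  [/\ symmetric e, irreflexive e, connected e
    & forall c1 c2, simple_cycle e c1 -> simple_cycle e c2 ->
        cycle_edges c1 != cycle_edges c2 ->
        #|[set x in c1] :&: [set x in c2]| <= 1].

(* [port v u] is the port number at [v] of the edge between [v] and [u]; its
   value is irrelevant when there is no such edge. *)
Definition port_numbering e port : Prop :=
  forall v, (forall u, e v u -> port v u < degree e v) /\
            {in [pred u | e v u] &, injective (port v)}.

Definition via e port (v : V) (p : nat) : option V :=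
  [pick u | e v u && (port v u == p)].

Fixpoint follow e port (v : V) (ps : seq nat) : option V :=
  if ps is p :: ps' then
    if via e port v p is Some u then follow e port u ps' else None
  else Some v.

(* A pair [(v, u)] of adjacent vertices is an edge traversed from [v] to [u];
   the face on its side is followed by leaving [u] through the port next to
   the port of arrival. *)
Definition face_step e port (d : V * V) : V * V :=
  if via e port d.2 ((port d.2 d.1).+1 %% degree e d.2) is Some w
  then (d.2, w) else d.

Definition faces e port : {set {set V * V}} :=
  [set [set x in orbit (face_step e port) d] | d : V * V & e d.1 d.2].

(* The port numbers are in counter-clockwise order around every vertex in some
   plane drawing of the connected graph [e]: by Euler's formula, the cyclic
   orders of the ports form a combinatorial map of genus 0. *)
Definition counter_clockwise e port : Prop :=
  #|V| + #|faces e port| = #|edges e| + 2.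

End Graphs.

(* An instance with [n] nodes and [m] agents, together with all the choices of
   the adversary.  The nodes are anonymous: agents never see elements of
   ['I_n].  Agents being deterministic, an adaptive adversary can do no more
   than a sequence of graphs fixed in advance.  [access r] is the order in which
   the agents get exclusive access to the whiteboards in round [r]. *)
Record environment (n m : nat) := Environment {
  graph : nat -> rel 'I_n;
  port : 'I_n -> 'I_n -> nat;
  home : 'I_n;
  black_hole : 'I_n;
  access : nat -> seq 'I_m
}.

Definition footprint n m (E : environment n m) : rel 'I_n := graph E 0.

Definition dynamic_cactus n (k : nat) (G : nat -> rel 'I_n) : Prop :=
  cactus (G 0) /\
  forall r, [/\ symmetric (G r), subrel (G r) (G 0),
                #|edges (G 0) :\: edges (G r)| <= k & connected (G r)].

Definition valid n m (k : nat) (E : environment n m) : Prop :=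
  [/\ m <= n, dynamic_cactus k (graph E),
      port_numbering (footprint E) (port E) /\
        counter_clockwise (footprint E) (port E),
      home E != black_hole E
    & forall r, perm_eq (access E r) (enum 'I_m)].

(* As nodes are anonymous, a location is reported as a list of port numbers to
   be followed in the footprint, starting either from the home or from the node
   where the reporting agent is. *)
Inductive location := FromHome of seq nat | FromHere of seq nat.

(* [Halt None] is termination without knowing where the black hole is. *)
Inductive action := Stay | Leave of nat | Halt of option location.

Inductive status := Active | Destroyed | Terminated of option location.

(* What an agent has at hand when it accesses the whiteboard.  [arrived] is the
   port through which it arrived if it moved in the previous round.
   Communication is complete: [others] lists the Id, the memory and the arrival
   port of every other agent at the node, by increasing Ids. *)
Record view := View {
  own_id : nat;
  memory : seq bool;
  arrived : option nat;
  node_degree : nat;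
  missing_ports : seq nat;
  others : seq (nat * seq bool * option nat);
  whiteboard : seq bool
}.

Record decision := Decision {
  new_memory : seq bool;
  new_whiteboard : seq bool;
  chosen : action
}.

Definition program := view -> decision.

(* All agents run the same program, which may depend on the number of nodes and
   on the maximum degree; a constant family is an algorithm that knows neither. *)
Definition algorithm := nat -> nat -> program.

Record agent (n : nat) := Agent {
  position : 'I_n;
  bits_of : seq bool;
  arrival : option nat;
  state : status
}.

Record configuration (n m : nat) := Configuration {
  agents : {ffun 'I_m -> agent n};
  boards : {ffun 'I_n -> seq bool}
}.

Section Execution.

Variables (n m : nat) (E : environment n m) (A : algorithm).
Implicit Types (c : configuration n m) (i j : 'I_m) (r t : nat).

Let G0 := footprint E.

Definition is_destroyed (a : agent n) : bool :=
  if state a is Destroyed then true else false.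

Definition together c i j : bool :=
  [&& j != i, ~~ is_destroyed (agents c j)
    & position (agents c j) == position (agents c i)].

Definition is_missing r (v : 'I_n) (p : nat) : bool :=
  if via G0 (port E) v p is Some u then ~~ graph E r v u else false.

(* The agent with index [i] has Id [i + 1]. *)
Definition view_of r c i (board : seq bool) : view :=
  let a := agents c i in
  View i.+1 (bits_of a) (arrival a)
    (degree G0 (position a))
    [seq p <- iota 0 (degree G0 (position a)) | is_missing r (position a) p]
    [seq (j.+1, bits_of (agents c j), arrival (agents c j))
       | j <- enum 'I_m & together c i j]
    board.

Definition perform r (v : 'I_n) (mem : seq bool) (x : action) : agent n :=
  match x with
  | Stay => Agent v mem None Active
  | Halt l => Agent v mem None (Terminated l)
  | Leave p =>
      if via G0 (port E) v p is Some u then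
        if graph E r v u then
          Agent u mem (Some (port E u v))
                (if u == black_hole E then Destroyed else Active)
        else Agent v mem None Active
      else Agent v mem None Active
  end.

(* Agent [i] takes its turn in round [r], which began in configuration [c];
   [c'] results from the turns already taken.  Everything but the whiteboard
   is observed in [c]. *)
Definition turn r c c' i : configuration n m :=
  let a := agents c i in
  let v := position a in
  if state a is Active then
    let d := A n (max_degree G0) (view_of r c i (boards c' v)) in
    Configuration
      [ffun j => if j == i then perform r v (new_memory d) (chosen d)
                 else agents c' j]
      [ffun u => if u == v then new_whiteboard d else boards c' u]
  else c'.

Definition round r c : configuration n m :=
  foldl (turn r c) c (access E r).

Definition start : configuration n m :=
  Configuration [ffun _ => Agent (home E) [::] None Active] [ffun _ => [::]].

Fixpoint run t : configuration n m :=
  if t is r.+1 then round r (run r) else start.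

Definition moves t : nat :=
  \sum_(r < t)
    #|[set i | position (agents (run r.+1) i) != position (agents (run r) i)]|.

Definition target (a : agent n) (l : location) : option 'I_n :=
  match l with
  | FromHome ps => follow G0 (port E) (home E) ps
  | FromHere ps => follow G0 (port E) (position a) ps
  end.

Definition reports t i l : Prop :=
  state (agents (run t) i) = Terminated (Some l).

Definition correct t i l : Prop :=
  target (agents (run t) i) l = Some (black_hole E).

Definition found t : Prop := exists i l, reports t i l /\ correct t i l.

(* The second part makes a report an expression of knowledge instead of a
   guess: no agent ever reports a wrong location. *)
Definition solved : Prop :=
  (exists t, found t) /\ (forall t i l, reports t i l -> correct t i l).

Definition completed_at t : Prop := found t /\ forall s, s < t -> ~ found s.

End Execution.

(* The number of binary digits of [x], which stands for [log x] in the space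
   bounds so that these are positive at degree 1; [k log k] becomes 1 for
   [k = 1]. *)
Definition log_bits (x : nat) : nat := (trunc_log 2 x).+1.

Definition bounded_space (k m : nat) (A : algorithm) : Prop :=
  exists C : nat, forall n (E : environment n m), valid k E -> forall t,
    (forall i, size (bits_of (agents (run E A t) i))
                 <= C * (n * log_bits (max_degree (footprint E)))) /\
    (forall v, size (boards (run E A t) v)
                 <= C * (degree (footprint E) v *
                         (log_bits (degree (footprint E) v) + k * log_bits k))).

Definition solves_bhs (k m : nat) (A : algorithm) : Prop :=
  forall n (E : environment n m), valid k E -> solved E A.

Definition rounds_on (k m : nat) (A : algorithm) (n t : nat) : Prop :=
  exists E : environment n m, valid k E /\ completed_at E A t.

Definition moves_on (k m : nat) (A : algorithm) (n x : nat) : Prop :=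
  exists (E : environment n m) (t : nat),
    [/\ valid k E, completed_at E A t & x = moves E A t].

(* [cost n x] means that [x] is the cost of some execution with [n] nodes; the
   worst case (the maximum of these costs) is at least [n / c] for all large
   [n]. *)
Definition worst_case_Omega_n (cost : nat -> nat -> Prop) : Prop :=
  exists c N : nat, 0 < c /\
    forall n, N <= n -> exists2 x, cost n x & n <= c * x.

(* Main.v *)
Require Import Defs.
From mathcomp Require Import all_boot zify.

Set Implicit Arguments.
Unset Strict Implicit.
Unset Printing Implicit Defensive.

(** The footprint is a path whose end is the home, with no edge ever missing.
    Whether the black hole is the last node or the last but one makes no
    difference to the agents until one of them enters one of these two nodes.
    A report made before that would be the same in both cases, hence wrong in
    one of them.  Reaching the last but one node takes [n - 2] moves of a single
    agent. *)

(** * Ports, and the path as a cactus *)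

Lemma via_port (V : finType) (e : rel V) port (v u : V) :
  port_numbering e port -> e v u -> via e port v (port v u) = Some u.
Proof.
move=> Hp evu; rewrite /via; case: pickP => [w /andP[evw /eqP pw] | /(_ u)].
  by congr Some; apply: (Hp v).2.
by rewrite evu eqxx.
Qed.

Definition path_rel n : rel 'I_n :=
  fun x y => (x.+1 == y :> nat) || (y.+1 == x :> nat).

(** Port 0 leads towards node 0 and port 1 away from it. The conjunct [0 < v] gives node 0, which
    has degree 1, the port 0. *)
Definition path_port n (v u : 'I_n) : nat := (0 < v) && (v < u).

Lemma path_rel_sym n : symmetric (@path_rel n).
Proof. by move=> x y; rewrite /path_rel orbC. Qed.

Lemma path_rel_irr n : irreflexive (@path_rel n).
Proof. by move=> x; rewrite /path_rel; lia. Qed.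

Lemma path_rel_connected n : connected (@path_rel n.+1).
Proof.
have csym : connect_sym (@path_rel n.+1).
  by apply: sym_connect_sym; apply: path_rel_sym.
suff H (x : 'I_n.+1) : connect (@path_rel n.+1) ord0 x.
  by move=> x y; apply: connect_trans (H y); rewrite csym.
case: x => i; elim: i => [|i IHi] lt_i.
  by rewrite (_ : Ordinal lt_i = ord0) ?connect0 //; apply: val_inj.
apply: connect_trans (IHi (ltnW lt_i)) (connect1 _).
by rewrite /path_rel /= eqxx.
Qed.

(** The largest vertex on a cycle would have its predecessor on the path as both of its neighbours,
    while a simple cycle has more than two vertices, all distinct. *)
Lemma path_rel_acyclic n (c : seq 'I_n) : ~~ simple_cycle (@path_rel n) c.
Proof.
apply/negP => /andP[sz /andP[cyc uc]].
have [x0 x0c] : exists x, x \in c.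
  by case: c sz {cyc uc} => // x c _; exists x; rewrite mem_head.
have [x xc xmax] := @arg_maxnP _ x0 (mem c) (@nat_of_ord n) x0c.
have [i s def_s] := rot_to xc.
have {}sz : 1 < size s by move: sz; rewrite -(size_rot i) def_s.
have {}cyc : cycle (@path_rel n) (x :: s) by rewrite -def_s rot_cycle.
have {}uc : uniq (x :: s) by rewrite -def_s rot_uniq.
have {}xmax y : y \in s -> y <= x.
  by move=> ys; apply: xmax; rewrite inE -(mem_rot i) def_s inE ys orbT.
case: s sz cyc uc xmax {def_s} => [|y s] //; case/lastP: s => [|s z] //= _.
rewrite rcons_path last_rcons => /andP[exy /andP[_ ezx]].
move=> /and3P[_ y_z _] xmax.
have le_y : y <= x by apply: xmax; rewrite mem_head.
have le_z : z <= x by apply: xmax; rewrite inE mem_rcons mem_head orbT.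
have eq_yz : y = z by apply: val_inj; move: exy ezx; rewrite /path_rel /=; lia.
by rewrite eq_yz mem_rcons mem_head in y_z.
Qed.

Lemma path_cactus n : cactus (@path_rel n.+1).
Proof.
split; [exact: path_rel_sym | exact: path_rel_irr | exact: path_rel_connected |].
by move=> c1 c2 H; rewrite (negPf (path_rel_acyclic c1)) in H.
Qed.

Lemma path_degree n (v : 'I_n.+1) :
  degree (@path_rel n.+1) v = (0 < v) + (v < n).
Proof.
have card_val k : #|[pred u : 'I_n.+1 | u == k :> nat]| = (k < n.+1).
  case: ltnP => [lt_k | le_k].
    transitivity #|pred1 (Ordinal lt_k)|; last exact: card1.
    by apply: eq_card => u; rewrite !inE.
  by apply: eq_card0 => u; apply/negbTE/eqP; have := ltn_ord u; lia.
have card_pred : #|[pred u : 'I_n.+1 | u.+1 == v]| = (0 < v).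
  case: posnP => [-> | v_gt0]; first exact: eq_card0.
  transitivity #|[pred u : 'I_n.+1 | u == v.-1 :> nat]|.
    by apply: eq_card => u; rewrite !inE; lia.
  by rewrite card_val; have := ltn_ord v; lia.
rewrite -card_pred -[v < n]/(v.+1 < n.+1) -card_val /degree.
rewrite -cardUI [X in _ + X]eq_card0 ?addn0 => [|u].
  by apply: eq_card => u; rewrite !inE /path_rel orbC [v.+1 == _]eq_sym.
by apply/negbTE/negP => /andP[/eqP /= ? /eqP /= ?]; lia.
Qed.

Lemma path_port_numbering n :
  port_numbering (@path_rel n.+1) (@path_port n.+1).
Proof.
move=> v; split=> [u | u w].
  rewrite path_degree /path_rel /path_port => evu.
  by have := ltn_ord u; have := ltn_ord v; lia.
rewrite !inE /path_rel /path_port => evu evw eq_p; apply: val_inj => /=.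
by have := ltn_ord u; have := ltn_ord v; lia.
Qed.

(** * Euler's formula and the instance on the path *)

Lemma path_face_step n (v u w : 'I_n.+1) :
  path_rel u w ->
  path_port u w = (path_port u v).+1 %% degree (@path_rel n.+1) u ->
  face_step (@path_rel n.+1) (@path_port n.+1) (v, u) = (u, w).
Proof.
move=> euw eq_p; rewrite /face_step /= -eq_p via_port //.
exact: path_port_numbering.
Qed.

(** A tree has a single face. Its walk climbs through [up 0], ..., [up n], turns, descends through
    [down n], ..., [down 0] and turns again. *)
Lemma path_faces n : #|faces (@path_rel n.+2) (@path_port n.+2)| = 1.
Proof.
pose f := face_step (@path_rel n.+2) (@path_port n.+2).
pose up i : 'I_n.+2 * 'I_n.+2 := (inord i, inord i.+1).
pose down i : 'I_n.+2 * 'I_n.+2 := (inord i.+1, inord i).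
have f_up i : i < n -> f (up i) = up i.+1.
  move=> lt_i; apply: path_face_step.
    by rewrite /path_rel !inordK //; lia.
  by rewrite path_degree /path_port !inordK; lia.
have f_down i : i < n -> f (down i.+1) = down i.
  move=> lt_i; apply: path_face_step.
    by rewrite /path_rel !inordK //; lia.
  by rewrite path_degree /path_port !inordK; lia.
(* An end of the path has degree 1, so the port next to the port of arrival is that same port and
   the walk turns back. *)
have f_last : f (up n) = down n.
  apply: path_face_step; first by rewrite /path_rel !inordK //; lia.
  by rewrite path_degree /path_port !inordK; lia.
have f_first : f (down 0) = up 0.
  apply: path_face_step; first by rewrite /path_rel !inordK //; lia.
  by rewrite path_degree /path_port !inordK; lia.
have c_up i j : i <= j <= n -> fconnect f (up i) (up j).
  elim: j => [|j IHj] H; first by rewrite (_ : i = 0) ?connect0 //; lia.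
  have [-> | ne_ij] := eqVneq i j.+1; first exact: connect0.
  apply: connect_trans (IHj _) _; first by lia.
  by rewrite -f_up ?fconnect1 //; lia.
have c_down i j : i <= j <= n -> fconnect f (down j) (down i).
  elim: j => [|j IHj] H; first by rewrite (_ : i = 0) ?connect0 //; lia.
  have [-> | ne_ij] := eqVneq i j.+1; first exact: connect0.
  apply: connect_trans (IHj _); last by lia.
  by rewrite -(f_down j) ?fconnect1 //; lia.
have c_last : fconnect f (up n) (down n) by rewrite -f_last fconnect1.
have c_first : fconnect f (down 0) (up 0) by rewrite -f_first fconnect1.
(* Reachability is proved both ways, as [fconnect] is not known to be symmetric before [f] is shown
   to be injective. *)
have c_all d : path_rel d.1 d.2 ->
    fconnect f d (up 0) /\ fconnect f (up 0) d.
  case: d => x y /= exy.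
  have [i [le_i def_d]] : exists i, i <= n /\ ((x, y) = up i \/ (x, y) = down i).
    have := ltn_ord x; have := ltn_ord y => lt_y lt_x.
    case/orP: exy => /eqP eq_xy; [exists x | exists y]; split; try by lia.
      by left; congr pair; apply: val_inj; rewrite /= inordK; lia.
    by right; congr pair; apply: val_inj; rewrite /= inordK; lia.
  have c_turn : fconnect f (up i) (down i).
    apply: connect_trans (c_up i n _) (connect_trans c_last (c_down i n _));
      by lia.
  have c_back : fconnect f (down i) (up i).
    apply: connect_trans (c_down 0 i _) (connect_trans c_first (c_up 0 i _));
      by lia.
  have c_start : fconnect f (down i) (up 0).
    by apply: connect_trans (c_down 0 i _) c_first; lia.
  have c_end : fconnect f (up 0) (up i) by apply: c_up; lia.
  case: def_d => ->; split=> //; first exact: connect_trans c_turn c_start.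
  exact: connect_trans c_end c_turn.
rewrite -[RHS](cards1 [set x in orbit f (up 0)]); congr #|pred_of_set _|.
apply/setP => F; rewrite inE; apply/imsetP/eqP => [[d] | ->].
  rewrite inE => /c_all[c1 c2] ->; apply/setP => x; rewrite !inE.
  rewrite -!fconnect_orbit; apply/idP/idP; exact: connect_trans.
exists (up 0); rewrite // inE /path_rel /= !inordK //.
Qed.

Lemma path_edges n : #|edges (@path_rel n.+1)| = n.
Proof.
pose edge (i : 'I_n) : {set 'I_n.+1} := [set inord i; inord i.+1].
have edge_inj : injective edge.
  move=> i j eq_ij; apply: val_inj => /=.
  have lt_i := ltn_ord i; have lt_j := ltn_ord j.
  (* The memberships say that [i] is [j] or [j + 1] and that [j] is [i] or [i + 1], which forces
     [i = j]. *)
  have : inord i \in edge j by rewrite -eq_ij !inE eqxx.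
  have : inord j \in edge i by rewrite eq_ij !inE eqxx.
  by rewrite !inE -!val_eqE /= !inordK; lia.
rewrite -[RHS]card_ord -cardsT -(card_imset _ edge_inj).
congr #|pred_of_set _|; apply/setP => e; apply/imsetP/imsetP => [[[x y]] | [i _ ->]].
  rewrite inE /= => /orP[] /eqP exy ->.
    have lt_x : x < n by have := ltn_ord y; lia.
    exists (Ordinal lt_x) => //; rewrite /edge /= exy.
    by rewrite !inord_val.
  have lt_y : y < n by have := ltn_ord x; lia.
  exists (Ordinal lt_y) => //; rewrite /edge /= exy.
  by rewrite !inord_val setUC.
exists (inord i, inord i.+1); rewrite // inE /path_rel /=.
by have lt_i := ltn_ord i; rewrite !inordK ?eqxx //; lia.
Qed.

Definition path_env n m (b : 'I_n.+1) : environment n.+1 m :=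
  Environment (fun _ => @path_rel n.+1) (@path_port n.+1) ord0 b
              (fun _ => enum 'I_m).

Lemma path_env_valid n m (b : 'I_n.+2) :
  m <= n.+2 -> b != ord0 -> valid 1 (path_env m b).
Proof.
move=> le_m b_neq0; split=> //=; last by rewrite eq_sym.
  split; first exact: path_cactus.
  move=> r; split=> //; [exact: path_rel_sym | | exact: path_rel_connected].
  by rewrite setDv cards0.
split; first exact: path_port_numbering.
(* Vertices, faces and edges give [(n + 2) + 1 = (n + 1) + 2]. *)
by rewrite /counter_clockwise path_faces path_edges card_ord; lia.
Qed.

(** * Executions in an arbitrary environment *)

Section Executions.

Variables (n m : nat) (A : algorithm).
Implicit Types (E : environment n m) (c : configuration n m).

(** Completion is at the least time with [found]. To take this minimum, [found] is made boolean: the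
    location is read off the agent's state instead of being quantified. *)
Lemma found_completed E t : found E A t -> exists s, completed_at E A s.
Proof.
pose p s := [exists i, if state (agents (run E A s) i) is Terminated (Some l)
  then target E (agents (run E A s) i) l == Some (black_hole E) else false].
have pP s : reflect (found E A s) (p s).
  apply: (iffP existsP) => -[i].
    case def_s: (state _) => [|| [l|]] // /eqP tgt.
    by exists i, l.
  by move=> [l [rep cor]]; exists i; rewrite rep cor.
move=> /pP pt; have exp : exists s, p s by exists t.
have [s ps s_min] := ex_minnP exp; exists s; split; first exact/pP.
by move=> u lt_us /pP /s_min; lia.
Qed.

Lemma moves_le E t : moves E A t <= m * t.
Proof.
rewrite mulnC -[t in t * m]card_ord -sum_nat_const; apply: leq_sum => r _.
by apply: leq_trans (max_card _) _; rewrite card_ord.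
Qed.

Lemma moves_mono E s t : s <= t -> moves E A s <= moves E A t.
Proof.
move/subnK <-; elim: (t - s) => // k IHk.
by apply: leq_trans IHk _; rewrite addSn /moves big_ord_recr leq_addr.
Qed.

(** A turn rewrites only the agent that takes it, so the position after an agent's last turn is its
    position at the end of the round. *)
Lemma foldl_turn_position E r c c' i s : i \notin s ->
  position (agents (foldl (turn E A r c) c' s) i) = position (agents c' i).
Proof.
elim: s c' => //= j s IHs c'; rewrite inE negb_or => /andP[ne_ij nis].
rewrite IHs // /turn; case: (state _) => //=.
by rewrite ffunE (negPf ne_ij).
Qed.

End Executions.

(** * Executions on the path *)

Section PathExecutions.

Variables (n m : nat) (A : algorithm).
Implicit Types (b : 'I_n.+1) (c : configuration n.+1 m).

Lemma round_position b r c i :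
  position (agents (round (path_env m b) A r c) i)
    <= (position (agents c i)).+1.
Proof.
rewrite /round; set f := turn _ _ _ _.
(* A turn computes the new position from [c] and not from the intermediate [c'], so the invariant on
   [c'] compares every agent with [c]. *)
suff H s c' : (forall j, position (agents c' j) <= (position (agents c j)).+1) ->
    position (agents (foldl f c' s) i) <= (position (agents c i)).+1.
  by apply: H => j; apply: leqnSn.
elim: s c' => [|k s IHs] c' Hc' /=; first exact: Hc'.
apply: IHs => j; rewrite /f /turn; case: (state _) => //=.
rewrite ffunE; case: eqP => [-> | _]; last exact: Hc'.
rewrite /perform; case: (chosen _) => [|p|l] //=.
case def_u: (via _ _ _ _) => [u|] //=; case: ifP => //= evu.
by move: evu; rewrite /path_rel; lia.
Qed.

Lemma position_le_moves b t i :
  position (agents (run (path_env m b) A t) i) <= moves (path_env m b) A t.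
Proof.
elim: t => [|t IHt]; first by rewrite /= ffunE.
rewrite /moves big_ord_recr /= -/(moves _ _ _).
(* [S] holds the agents that move in this round; if [i] is one of them, its own move pays for one
   more step along the path. *)
set S := [set _ | _]; case: (boolP (i \in S)) => [iS | ].
  have S_gt0 : 0 < #|S| by apply/card_gt0P; exists i.
  apply: leq_trans (round_position b t _ i) _.
  by rewrite -addn1 leq_add.
rewrite inE negbK => /eqP /= ->; exact: leq_trans IHt (leq_addr _ _).
Qed.

(** Views do not depend on the black hole; it matters only in [perform], when the node of arrival is
    compared with it. *)
Lemma round_indistinguishable b1 b2 r c :
  (forall i, position (agents (round (path_env m b1) A r c) i) != b1 /\
             position (agents (round (path_env m b1) A r c) i) != b2) ->
  round (path_env m b1) A r c = round (path_env m b2) A r c.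
Proof.
(* As each agent has one turn, safety at the end of the fold also gives safety right after each
   turn. *)
suff H s c' : uniq s ->
    (forall i, let a := agents (foldl (turn (path_env m b1) A r c) c' s) i in
       position a != b1 /\ position a != b2) ->
    foldl (turn (path_env m b1) A r c) c' s =
      foldl (turn (path_env m b2) A r c) c' s.
  exact: H (enum_uniq _).
elim: s c' => //= i s IHs c' /andP[nis us] safe.
have eq_turn : turn (path_env m b1) A r c c' i = turn (path_env m b2) A r c c' i.
  have := safe i; rewrite foldl_turn_position // /turn.
  case: (state _) => //=; rewrite ffunE eqxx /view_of /is_missing /footprint /=.
  set d := A _ _ _ => safe_i; congr Configuration.
  apply/ffunP => j; rewrite !ffunE; case: eqP => // _.
  move: safe_i; rewrite /perform /footprint /=; case: (chosen d) => [|p|l] //=.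
  case: (via _ _ _ _) => [u|] //; case: ifP => //= _ [].
  by move=> /negPf -> /negPf ->.
by rewrite -eq_turn; apply: IHs.
Qed.

(** By [position_le_moves], no agent has got as far as [b1] or [b2]; as [moves] is monotone, the
    same holds in every earlier round. *)
Lemma run_indistinguishable b1 b2 t :
  moves (path_env m b1) A t < b1 -> moves (path_env m b1) A t < b2 ->
  run (path_env m b1) A t = run (path_env m b2) A t.
Proof.
elim: t => // t IHt lt1 lt2.
have le_t : moves (path_env m b1) A t <= moves (path_env m b1) A t.+1.
  exact: moves_mono.
rewrite /= -IHt; try exact: leq_ltn_trans le_t _.
apply: round_indistinguishable => i.
have := position_le_moves b1 t.+1 i; rewrite -!val_eqE /=.
by split; apply/eqP; lia.
Qed.

End PathExecutions.

(** * The lower bounds *)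

Lemma path_moves_lower_bound n m (A : algorithm) t : m <= n.+3 ->
  solves_bhs 1 m A -> found (path_env m (@ord_max n.+2)) A t ->
  n.+1 <= moves (path_env m (@ord_max n.+2)) A t.
Proof.
move=> le_m A_solves [i [l [rep cor]]]; rewrite leqNgt; apply/negP => lt_mv.
(* The nodes are [0], ..., [n + 2], so [b] is the last but one and the number of moves is assumed to
   be below both candidates. *)
pose b : 'I_n.+3 := inord n.+1.
have b_val : b = n.+1 :> nat by rewrite inordK.
have eq_run : run (path_env m ord_max) A t = run (path_env m b) A t.
  by apply: run_indistinguishable; rewrite ?b_val //=; lia.
have b_valid : valid 1 (path_env m b).
  by apply: path_env_valid; rewrite // -val_eqE /= b_val.
have [_ sound] := A_solves _ _ b_valid.
have cor' : correct (path_env m b) A t i l.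
  by apply: sound; rewrite /reports -eq_run.
(* [target] ignores the black hole, so [cor] and [cor'] give two values to the same expression. *)
have : Some b = Some (@ord_max n.+2).
  by rewrite -[RHS]cor eq_run.
by move=> [] /(congr1 val) /=; rewrite b_val; lia.
Qed.

Theorem theorem3 (A : algorithm)
  (A_space : bounded_space 1 4 A) (A_solves : solves_bhs 1 4 A) :
  worst_case_Omega_n (rounds_on 1 4 A) /\ worst_case_Omega_n (moves_on 1 4 A).
Proof.
(* [valid] asks for at least as many nodes as agents, hence [4 <= n]. *)
have hard n : 4 <= n -> exists (E : environment n 4) (t : nat),
    [/\ valid 1 E, completed_at E A t & n - 2 <= moves E A t].
  case: n => [|[|[|n]]] // le_n; pose E := path_env 4 (@ord_max n.+2).
  have E_valid : valid 1 E by apply: path_env_valid.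
  have [[t0 found_t0] _] := A_solves _ _ E_valid.
  have [t compl_t] := found_completed found_t0.
  exists E, t; split=> //.
  by apply: path_moves_lower_bound => //; case: compl_t.
split.
  (* For [n >= 4], [n <= 2 * (n - 2)], which is at most twice the number of moves. Four agents make
     at most 4 moves per round, so the factor is 8 for rounds and 2 for moves. *)
  exists 8, 4; split=> // n le_n; have [E [t [E_valid compl_t le_mv]]] := hard n le_n.
  by exists t; [exists E | have := moves_le A E t; lia].
exists 2, 4; split=> // n le_n; have [E [t [E_valid compl_t le_mv]]] := hard n le_n.
by exists (moves E A t); [exists E, t | lia].
Qed.
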